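(* Assume Hypothesis (H), and let $b=b_1+b_2$, $M=N-P$ be splittings as described, with $J(x):=N-b_1(\cdot,x)$, $g(x):=a+Px+b_2(x,x)$, $f(x):=J(x)^{-1}g(x)$. Let $\hat f(x):=(M-b(\cdot,x))^{-1}a$ (the map obtained for the particular choice $b_1=b$, $b_2=0$, $N=M$, $P=0$). Then for every $x$ with $0\leq x\leq x_\ast$ and $F(x)\leq 0$, and every integer $k\geq 0$, one has $\hat f^{\,k}(x)\geq f^{\,k}(x)$ (where $f^k$ denotes the $k$-fold composition).
   Context: Inequalities between vectors/matrices are componentwise. An M-matrix is a matrix $sI-P$ with $P\geq0$ entrywise and $s\geq\rho(P)$ ($\rho$ = spectral radius). Let $M\in\mathbb R^{n\times n}$ be a nonsingular M-matrix, $a\in\mathbb R^n$ with $a\geq 0$, and $b:\mathbb R^n\times\mathbb R^n\to\mathbb R^n$ a bilinear map (not necessarily symmetric) with $b(x,y)\geq 0$ whenever $x,y\geq 0$. A solution of $Mx=a+b(x,x)$ means a vector $x\geq 0$ satisfying it; a solution $x_\ast$ is minimal if $x_\ast\leq y$ for every solution $y$. $F(x):=Mx-a-b(x,x)$. For a bilinear map $c$ and $x\in\mathbb R^n$, $c(x,\cdot)$ and $c(\cdot,x)$ denote the $n\times n$ matrices of $y\mapsto c(x,y)$ and $y\mapsto c(y,x)$; $F'_x:=M-b(x,\cdot)-b(\cdot,x)$. Hypothesis (H): the equation has a minimal solution $x_\ast$, $x_\ast>0$ (all components strictly positive), and either $F'_{x_\ast}$ is nonsingular, or $F'_{x_\ast}$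 is irreducible and $F'_x\neq F'_{x_\ast}$ for every $x$ with $0\leq x\leq x_\ast$, $x\neq x_\ast$. Splittings: $b=b_1+b_2$ with $b_1,b_2$ bilinear and $b_i(x,y)\geq0$ for $x,y\geq0$; $M=N-P$ with $N$ an M-matrix and $P\geq 0$. *)

(* Defs.v *)
(* Scalars live in an arbitrary numClosedFieldType C
   (e.g. the complex numbers); "real" vectors/matrices are those whose
   entries are in Num.real.  Complex scalars are needed only to define the
   spectral radius (moduli of the complex eigenvalues). *)
From HB Require Import structures.
From mathcomp Require Import all_boot all_order all_algebra.
Set Implicit Arguments. Unset Strict Implicit. Unset Printing Implicit Defensive.
Import Order.TTheory GRing.Theory Num.Theory.
Local Open Scope ring_scope.

Section Defs.
Variables (C : numClosedFieldType) (n : nat).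

Definition mxle (m p : nat) (A B : 'M[C]_(m, p)) : Prop :=
  forall i j, A i j <= B i j.
Definition mxpos (m p : nat) (A : 'M[C]_(m, p)) : Prop :=
  forall i j, 0 < A i j.

Definition realmx (m p : nat) (A : 'M[C]_(m, p)) : Prop :=
  forall i j, A i j \is Num.real.

Definition specrad_le (P : 'M[C]_n) (s : C) : Prop :=
  forall lam, root (char_poly P) lam -> `|lam| <= s.

Definition Mmatrix (A : 'M[C]_n) : Prop :=
  exists (s : C) (P : 'M[C]_n),
    s \is Num.real /\ mxle 0 P /\ specrad_le P s /\ A = s%:M - P.

Definition nonsingular_Mmatrix (A : 'M[C]_n) : Prop :=
  Mmatrix A /\ A \in unitmx.

(* irreducible: no nonempty proper index set I with A i j = 0 for all
   i in I, j not in I (i.e. A not permutation-similar to block triangular) *)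
Definition irreducible_mx (A : 'M[C]_n) : Prop :=
  forall I : {set 'I_n}, I != set0 -> I != setT ->
    exists i j, [/\ i \in I, j \notin I & A i j != 0].

(* bilinear maps R^n x R^n -> R^n given by their coefficient tensor:
   b(x,y)_i = sum_{j,k} B i j k x_j y_k *)
Definition tensor := 'I_n -> 'I_n -> 'I_n -> C.
Definition real_tensor (B : tensor) : Prop :=
  forall i j k, B i j k \is Num.real.

Definition bil (B : tensor) (x y : 'cV[C]_n) : 'cV[C]_n :=
  \col_i \sum_j \sum_k B i j k * x j 0 * y k 0.

(* matrix of y |-> b(x,y) *)
Definition bilL (B : tensor) (x : 'cV[C]_n) : 'M[C]_n :=
  \matrix_(i, k) \sum_j B i j k * x j 0.
(* matrix of y |-> b(y,x) *)
Definition bilR (B : tensor) (x : 'cV[C]_n) : 'M[C]_n :=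
  \matrix_(i, j) \sum_k B i j k * x k 0.

Definition nonneg_bil (B : tensor) : Prop :=
  forall x y : 'cV[C]_n, mxle 0 x -> mxle 0 y -> mxle 0 (bil B x y).

Definition Ffun (M : 'M[C]_n) (a : 'cV[C]_n) (B : tensor) (x : 'cV[C]_n) :=
  M *m x - a - bil B x x.
Definition Fder (M : 'M[C]_n) (B : tensor) (x : 'cV[C]_n) : 'M[C]_n :=
  M - bilL B x - bilR B x.

Definition is_solution M a B (x : 'cV[C]_n) : Prop :=
  mxle 0 x /\ M *m x = a + bil B x x.

Definition minimal_solution M a B (xs : 'cV[C]_n) : Prop :=
  is_solution M a B xs /\ forall y, is_solution M a B y -> mxle xs y.

Definition hypH M a B (xs : 'cV[C]_n) : Prop :=
  [/\ minimal_solution M a B xs, mxpos xs &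
      (Fder M B xs \in unitmx \/
       (irreducible_mx (Fder M B xs) /\
        forall x, mxle 0 x -> mxle x xs -> x != xs -> Fder M B x != Fder M B xs))].

Definition Jmap (N : 'M[C]_n) (B1 : tensor) x := N - bilR B1 x.
Definition gmap a (P : 'M[C]_n) (B2 : tensor) x := a + P *m x + bil B2 x x.
Definition fmap N P a B1 B2 (x : 'cV[C]_n) : 'cV[C]_n :=
  invmx (Jmap N B1 x) *m gmap a P B2 x.
Definition fhat M a B (x : 'cV[C]_n) : 'cV[C]_n :=
  invmx (M - bilR B x) *m a.

End Defs.

(* Main.v *)
Require Import Defs.
From HB Require Import structures.
From mathcomp Require Import all_boot all_order all_algebra lra.
From mathcomp Require Import polyrcf ordered_qelim qe_rcf.
Set Implicit Arguments. Unset Strict Implicit. Unset Printing Implicit Defensive.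
Import Order.TTheory GRing.Theory Num.Theory.
Local Open Scope ring_scope.

(** Everything rests on the invertibility and inverse-nonnegativity of
    A := M - b(., xs).  It is a Z-matrix with A xs = a >= 0 and xs > 0, so
    failure would give a nonempty index set I such that a vanishes on I and A
    has no entry in I x I^c.  Then xs with its I-components replaced by 0 is a
    supersolution.  The componentwise infimum of the supersolutions below it is
    a solution vanishing on I, contradicting the minimality of xs.  The infimum
    exists over any real closed field since the set is first-order definable;
    the scalars are therefore restricted to the real elements of C.

    For 0 <= x <= xs both J(x) and M - b(., x) are Z-matrices above A, hence
    inverse-nonnegative.  The set {0 <= x <= xs, F(x) <= 0} is f-stable, with
    x <= f(x) <= fhat(x) there, and fhat is monotone on [0, xs]; the theorem
    follows by induction on k. *)

(** * The real elements of [C] form a real closed field *)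

(** As a subtype it inherits the field operations of [C], and [val] becomes a ring morphism back
    into [C] along which order and norm are pulled back. *)
Record realsub (C : numClosedFieldType) :=
  RealSub { realsub_val :> C; _ : realsub_val \is Num.real }.

Section RealSub.
Variable C : numClosedFieldType.

HB.instance Definition _ := [isSub of realsub C for @realsub_val C].
HB.instance Definition _ := [Choice of realsub C by <:].
HB.instance Definition _ := [SubChoice_isSubIntegralDomain of realsub C by <:].
HB.instance Definition _ := [SubIntegralDomain_isSubField of realsub C by <:].

Implicit Types x y : realsub C.
Definition rs_le x y := (val x <= val y).
Definition rs_lt x y := (val x < val y).
Definition rs_norm x : realsub C := RealSub (normr_real (val x)).

Lemma rs_le0D x y : rs_le 0 x -> rs_le 0 y -> rs_le 0 (x + y).
Proof. exact: addr_ge0. Qed.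
Lemma rs_le0M x y : rs_le 0 x -> rs_le 0 y -> rs_le 0 (x * y).
Proof. exact: mulr_ge0. Qed.
Lemma rs_le0_anti x : rs_le 0 x -> rs_le x 0 -> x = 0.
Proof. by move=> x0 x1; apply/val_inj/le_anti/andP; split. Qed.
Lemma rs_subr_ge0 x y : rs_le 0 (y - x) = rs_le x y.
Proof. exact: subr_ge0. Qed.
Lemma rs_le0_total x : rs_le 0 x || rs_le x 0.
Proof. exact: (valP x). Qed.
Lemma rs_normN x : rs_norm (- x) = rs_norm x.
Proof. by apply/val_inj; rewrite /= normrN. Qed.
Lemma rs_ge0_norm x : rs_le 0 x -> rs_norm x = x.
Proof. by move=> x0; apply/val_inj; rewrite /= ger0_norm. Qed.
Lemma rs_lt_def x y : rs_lt x y = (y != x) && rs_le x y.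
Proof. by rewrite /rs_lt lt_def. Qed.

HB.instance Definition _ := Num.IntegralDomain_isLeReal.Build (realsub C)
  rs_le0D rs_le0M rs_le0_anti rs_subr_ge0 rs_le0_total rs_normN rs_ge0_norm
  rs_lt_def.

HB.instance Definition _ :=
  GRing.isZmodMorphism.Build (realsub C) C (@realsub_val C) (fun x y => erefl).
HB.instance Definition _ :=
  GRing.isMonoidMorphism.Build (realsub C) C (@realsub_val C)
    (conj erefl (fun x y => erefl)).

(** Induction on the size of [p], which has a root in the algebraically closed [C]. A real root in
    [a, b] finishes; any other root yields a real factor, linear or quadratic, with one strict sign
    at both ends, and this factor is divided out. *)
Lemma realsub_ivt : Num.real_closed_axiom (realsub C).
Proof.
move=> p a b leab.
have [n] := ubnP (size p); elim: n p => // n IHn p size_p /andP[pa pb].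
have [p0|p_neq0] := eqVneq p 0.
  by exists a; rewrite ?lexx // p0 root0.
have [size_le1|size_gt1] := leqP (size p) 1.
  exists a; rewrite ?lexx //; rewrite (size1_polyC size_le1) !hornerC in pa pb *.
  by rewrite rootC; apply/eqP/le_anti/andP.
(* After division by a factor of one strict sign at [a] and [b], the quotient [q], or [- q] if that
   sign is negative, still passes from nonpositive to nonnegative. *)
have IHdiv (d : {poly realsub C}) : (1 < size d)%N -> d %| p ->
    (0 <= d.[a] /\ 0 <= d.[b]) \/ (d.[a] <= 0 /\ d.[b] <= 0) ->
    d.[a] != 0 -> d.[b] != 0 ->
    exists2 x, a <= x <= b & root p x.
  move=> size_d /dvdpP[q def_p] dsgn da db.
  have q_neq0 : q != 0 by apply: contraNneq p_neq0 => q0; rewrite def_p q0 mul0r.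
  have size_q : (size q < n)%N.
    rewrite -ltnS; apply: leq_trans size_p.
    rewrite ltnS def_p size_mul // -?size_poly_gt0 ?(ltn_trans _ size_d) //.
    by case: (size d) size_d => [|[|k]] // _; rewrite !addnS /= ltnS leq_addr.
  have [x abx] : exists2 x, a <= x <= b & root q x.
    rewrite def_p !hornerM in pa pb.
    case: dsgn => -[da0 db0].
      have {}da0 : 0 < d.[a] by rewrite lt_def da.
      have {}db0 : 0 < d.[b] by rewrite lt_def db.
      by apply: IHn => //; rewrite -(pmulr_lle0 _ da0) pa -(pmulr_lge0 _ db0).
    have {}da0 : d.[a] < 0 by rewrite lt_neqAle da.
    have {}db0 : d.[b] < 0 by rewrite lt_neqAle db.
    have [||x abx] := IHn (- q); first by rewrite size_polyN.
      by rewrite !hornerN oppr_le0 oppr_ge0 -(nmulr_lle0 _ da0) pa -(nmulr_lge0 _ db0).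
    by rewrite rootN; exists x.
  by move=> rqx; exists x; rewrite // def_p rootM rqx.
have /closed_rootP[z] : size (map_poly (val : realsub C -> C) p) != 1.
  by rewrite size_map_poly gtn_eqF.
have [z_real|z_nreal] := boolP (z \is Num.real).
  rewrite -[z]/(val (RealSub z_real)) fmorph_root; set r := RealSub _ => pr0.
  have [/andP[ar rb]|] := boolP (a <= r <= b); first by exists r; rewrite ?ar.
  rewrite negb_and -!ltNge => rab.
  apply: (IHdiv ('X - r%:P)); rewrite ?size_XsubC ?dvdp_XsubCl //.
  - rewrite !hornerXsubC !subr_ge0 !subr_le0.
    case/orP: rab => [ra|br]; [left|right]; first by rewrite (ltW ra) (le_trans (ltW ra)).
    by rewrite (ltW br) (le_trans leab) ?ltW.
  - rewrite hornerXsubC subr_eq0; case/orP: rab => [ra|br]; first by rewrite gt_eqF.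
    by rewrite lt_eqF // (le_lt_trans leab).
  - rewrite hornerXsubC subr_eq0; case/orP: rab => [ra|br]; last by rewrite lt_eqF.
    by rewrite gt_eqF // (lt_le_trans ra).
move=> pz0.
(* A nonreal root [z] = u + iv gives the factor (X - u)^2 + v^2, the product of X - z and its
   conjugate; it is positive everywhere because v is nonzero. *)
pose u : realsub C := RealSub (Creal_Re z); pose v : realsub C := RealSub (Creal_Im z).
have v_neq0 : v != 0.
  by apply: contraNneq z_nreal => /(congr1 val) /= v0; apply/Creal_ImP.
have d_gt0 x : 0 < (('X - u%:P) ^+ 2 + (v ^+ 2)%:P).[x].
  by rewrite !hornerE ltr_wpDl ?sqr_ge0 // lt_def sqr_ge0 sqrf_eq0 v_neq0.
apply: (IHdiv (('X - u%:P) ^+ 2 + (v ^+ 2)%:P)); rewrite ?gt_eqF //; last by left; split; apply/ltW.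
  rewrite size_addl size_exp_XsubC // size_polyC; by case: eqP.
rewrite -(dvdp_map (val : {rmorphism realsub C -> C})).
have -> : map_poly (val : realsub C -> C) (('X - u%:P) ^+ 2 + (v ^+ 2)%:P) =
          ('X - z%:P) * ('X - z^*%:P).
  rewrite rmorphD rmorphXn /= map_polyXsubC map_polyC /=.
  rewrite [in RHS](Crect z) conjC_rect ?Creal_Re ?Creal_Im //.
  rewrite !rmorphD !rmorphN /= !opprD !addrA opprK -subr_sqr -[RHS]/(_ + - _); congr (_ + _).
  by rewrite -rmorphXn /= -rmorphN /= exprMn sqrCi mulN1r opprK -expr2.
(* The two linear factors are coprime since [z] is not real, and the conjugate of [z] is a root
   because the coefficients of [p] are fixed by conjugation. *)
rewrite Gauss_dvdp ?dvdp_XsubCl ?pz0 /=; last first.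
  by rewrite coprimep_XsubC root_XsubC -CrealE.
suff -> : map_poly (val : realsub C -> C) p =
    map_poly Num.conj (map_poly (val : realsub C -> C) p) by rewrite fmorph_root.
rewrite -map_poly_comp; apply: eq_map_poly => x /=.
by rewrite (CrealP (valP x)).
Qed.

HB.instance Definition _ := Num.RealField_isClosed.Build (realsub C) realsub_ivt.
End RealSub.

(** * Infima of definable sets *)

(** The relation is kept arbitrary so that the reversed order gives minima as well as maxima. *)
Lemma seq_extremum (T : eqType) (le : rel T) (s : seq T) (p : pred T) x :
  total le -> transitive le -> x \in s -> p x ->
  exists m, [/\ m \in s, p m & forall r, r \in s -> p r -> le r m].
Proof.
move=> le_total le_trans.
elim: s x => [//|y s IHs] x xys px.
have [/hasP[z zs pz]|s_p] := boolP (has p s).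
  have [m [ms pm m_max]] := IHs z zs pz.
  have [py|npy] := boolP (p y); last first.
    exists m; split=> [||r]; rewrite ?in_cons ?ms ?orbT // => /orP[/eqP->|].
      by rewrite (negPf npy).
    exact: m_max.
  have [le_ym|le_my] := orP (le_total y m).
    exists m; split=> [||r]; rewrite ?in_cons ?ms ?orbT // => /orP[/eqP->|] //.
    exact: m_max.
  exists y; split=> [||r]; rewrite ?mem_head // in_cons => /orP[/eqP->|rs pr].
    by move=> _; case/orP: (le_total y y).
  exact: le_trans (m_max r rs pr) le_my.
move: xys; rewrite in_cons => /orP[/eqP xy|xs]; last by case/hasP: s_p; exists x.
exists y; rewrite -xy mem_head px; split=> // r.
rewrite in_cons => /orP[/eqP->|rs pr]; last by case/hasP: s_p; exists r.
by move=> _; case/orP: (le_total x x).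
Qed.

(** * One-variable semialgebraic sets and their infima *)

Section Tame.
Variable R : rcfType.

(** This is one-dimensional o-minimality: the set is a finite union of points and open intervals
    delimited by [s]. *)
Definition tame (P : pred R) := exists s : seq R, forall x y,
  x <= y -> (forall r, r \in s -> ~~ (x <= r <= y)) -> P x = P y.

Lemma tame_op (op : bool -> bool -> bool) (P Q : pred R) :
  tame P -> tame Q -> tame (fun x => op (P x) (Q x)).
Proof.
move=> [s Ps] [t Qt]; exists (s ++ t) => x y lexy st.
rewrite (Ps x y) ?(Qt x y) // => r r_in; apply: st;
  by rewrite mem_cat r_in ?orbT.
Qed.

(** The sign changes only at roots. The test [h] covers the atoms with =, < and <= at once. *)
Lemma tame_sg (h : R -> bool) (p : {poly R}) : tame (fun x => h (Num.sg p.[x])).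
Proof.
have [->|p_neq0] := eqVneq p 0; first by exists [::] => x y; rewrite !horner0.
exists (rootsR p) => x y lexy noroots; congr h.
apply: (@polyrN0_itv _ `[x, y]); rewrite ?in_itv /= ?lexx ?lexy //.
move=> r; rewrite in_itv /= => rxy; apply/negP => pr0.
have := roots_on_rootsR p_neq0 r; rewrite in_itv pr0 /= => /esym/noroots.
by rewrite rxy.
Qed.

(** With the other variables fixed by [e], a ring term is a polynomial in variable [i], extracted by
    [abstrX]. *)
Lemma tame_term2 (h : R -> bool) e i (t u : GRing.term R) :
  GRing.rterm t -> GRing.rterm u ->
  tame (fun x => h (Num.sg (GRing.eval (set_nth 0 e i x) t
                            - GRing.eval (set_nth 0 e i x) u))).
Proof.
move=> rt ru.
have poly_of v : GRing.rterm v ->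
    exists p : {poly R}, forall x, GRing.eval (set_nth 0 e i x) v = p.[x].
  move=> rv; exists (eval_poly e (abstrX i (to_rterm v))) => x.
  by rewrite abstrXP evalE to_rtermE.
have [[p pE] [q qE]] := (poly_of t rt, poly_of u ru).
have [s Ps] := tame_sg h (p - q); exists s => x y lexy /(Ps _ _ lexy).
by rewrite !hornerE !pE !qE.
Qed.

Lemma tame_qf e i (f : ord.formula R) :
  ord.qf_form f -> ord.rformula f ->
  tame (fun x => ord.qf_eval (set_nth 0 e i x) f).
Proof.
elim: f => //=.
- by move=> b _ _; exists [::].
- move=> t u _ /andP[rt ru].
  have [s Ps] := tame_term2 (fun z => z == 0) e i rt ru.
  by exists s => x y lexy /(Ps _ _ lexy); rewrite !sgr_eq0 !subr_eq0.
- move=> t u _ /andP[rt ru].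
  have [s Ps] := tame_term2 (fun z => z < 0) e i rt ru.
  by exists s => x y lexy /(Ps _ _ lexy); rewrite !sgr_lt0 !subr_lt0.
- move=> t u _ /andP[rt ru].
  have [s Ps] := tame_term2 (fun z => z <= 0) e i rt ru.
  by exists s => x y lexy /(Ps _ _ lexy); rewrite !sgr_le0 !subr_le0.
- move=> f IHf g IHg /andP[qf qg] /andP[rf rg].
  exact: (tame_op andb (IHf qf rf) (IHg qg rg)).
- move=> f IHf g IHg /andP[qf qg] /andP[rf rg].
  exact: (tame_op orb (IHf qf rf) (IHg qg rg)).
- move=> f IHf g IHg /andP[qf qg] /andP[rf rg].
  exact: (tame_op implb (IHf qf rf) (IHg qg rg)).
move=> f IHf qf rf.
(* Negation is passed as a binary operation that ignores its second argument. *)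
exact: (tame_op (fun b _ => ~~ b) (IHf qf rf) (IHf qf rf)).
Qed.

(** The infimum is found among finitely many candidates [c]: it is the largest one that is a lower
    bound, and being a lower bound can be tested at finitely many points. *)
Lemma tame_inf (P : pred R) l x0 : tame P -> P x0 -> (forall x, P x -> l <= x) ->
  exists m, (forall x, P x -> m <= x) /\
    (forall eps, 0 < eps -> exists2 x, P x & x < m + eps).
Proof.
move=> [s Ps] Px0 lP.
(* The test points [T] are the candidates and all their midpoints, so every gap between neighbouring
   candidates contains one. *)
pose c := [:: l, x0 & s]; pose T := c ++ [seq (u + v) / 2 | u <- c, v <- c].
have same x y : (forall r, r \in c -> r < Num.min x y \/ Num.max x y < r) ->
    P x = P y.
  wlog lexy : x y / x <= y.
    move=> H cP; have [lexy|/ltW leyx] := leP x y; first exact: H.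
    by apply/esym/H => // r; rewrite minC maxC; apply: cP.
  rewrite (min_idPl lexy) (max_idPr lexy) => cP; apply: Ps => // r rs.
  rewrite negb_and -!ltNge; apply/orP.
  by apply: (cP r); rewrite !in_cons rs !orbT.
have above x r : r \in c -> x < r ->
    exists v, [/\ v \in c, x < v & forall r', r' \in c -> x < r' -> v <= r'].
  move=> rc xr; apply: (seq_extremum (le := fun a b => b <= a)) rc xr.
    by move=> a b; apply: le_total.
  by move=> a b d ab da; apply: le_trans da ab.
have below x r : r \in c -> r < x ->
    exists u, [/\ u \in c, u < x & forall r', r' \in c -> r' < x -> r' <= u].
  move=> rc rx; apply: (seq_extremum (p := fun r => r < x)) rc rx.
    exact: le_total.
  exact: le_trans.
pose lbT r := all (fun t => P t ==> (r <= t)) T.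
(* A point of [P] below [r] and outside [c] lies between neighbouring candidates u and v with v <=
   r; their midpoint also satisfies [P] and violates the test. *)
have lbTP r : r \in c -> lbT r -> forall x, P x -> r <= x.
  move=> rc /allP rT x Px; rewrite leNgt; apply/negP => xr.
  have [xc|xnc] := boolP (x \in c).
    by have := rT x; rewrite mem_cat xc Px /= leNgt xr => /(_ isT).
  have lx : l < x.
    rewrite lt_neqAle lP // andbT; apply: contraNneq xnc => <-; exact: mem_head.
  have [u [uc ux u_max]] := below x l (mem_head _ _) lx.
  have [v [vc xv v_min]] := above x r rc xr.
  have [umid midv] := midf_lt (lt_trans ux xv).
  set mid := _ / _ in umid midv.
  have midT : mid \in T by rewrite mem_cat (allpairs_f (fun u v => (u + v) / 2)) ?orbT.
  have Pmid : P mid.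
    rewrite (same mid x) // => r' r'c; rewrite lt_min gt_max.
    case: (ltgtP r' x) => [r'x|xr'|r'x]; last by rewrite -r'x r'c in xnc.
      by left; rewrite (le_lt_trans _ umid) ?u_max.
    by right; rewrite (lt_le_trans midv) ?v_min.
  have := rT mid midT; rewrite Pmid /= => /le_lt_trans/(_ midv).
  by rewrite ltNge v_min.
have lT : lbT l by apply/allP => t _; apply/implyP/lP.
have [m [mc mT m_max]] : exists m, [/\ m \in c, lbT m &
    forall r, r \in c -> lbT r -> r <= m].
  by apply: seq_extremum lT => //; [exact: le_total | exact: le_trans | exact: mem_head].
exists m; split=> [|eps eps_gt0]; first exact: lbTP.
have [Pm|nPm] := boolP (P m); first by exists m; rewrite // ltrDl.
have mlt x : P x -> m < x.
  move=> Px; rewrite lt_neqAle (lbTP m) // andbT.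
  by apply: contraNneq nPm => ->.
have x0c : x0 \in c by rewrite !in_cons eqxx orbT.
(* The next candidate [v] above [m] fails the test, so some [t] < [v] satisfies [P]. No candidate
   lies strictly between [m] and [v], so [P] also holds at m + eps/2 when this is at most [t]. *)
have [v [vc mv v_min]] := above m x0 x0c (mlt _ Px0).
have /allPn[t tT] : ~~ lbT v.
  by apply/negP => /(m_max v vc); rewrite leNgt mv.
rewrite negb_imply -ltNge => /andP[Pt tv].
have [/= | tlt] := leP (m + eps / 2) t; last first.
  by exists t => //; apply: (lt_trans tlt); rewrite ltrD2l ltr_pdivrMr // ltr_pMr // ltr1n.
move=> let_; exists (m + eps / 2); last first.
  by rewrite ltrD2l ltr_pdivrMr // ltr_pMr // ltr1n.
rewrite (same _ t) // => r rc; rewrite (min_idPl let_) (max_idPr let_).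
have [mr|rm] := ltP m r; first by right; rewrite (lt_le_trans tv) ?v_min.
by left; rewrite (le_lt_trans rm) // ltrDl divr_gt0.
Qed.

(** Quantifier elimination over real closed fields turns [f] into a quantifier-free formula, which
    is tame in variable [i]. *)
Lemma definable_inf e i (f : ord.formula R) l x0 : ord.rformula f ->
  ord.holds (set_nth 0 e i x0) f ->
  (forall x, ord.holds (set_nth 0 e i x) f -> l <= x) ->
  exists m, (forall x, ord.holds (set_nth 0 e i x) f -> m <= x) /\
    (forall eps, 0 < eps ->
      exists2 x, ord.holds (set_nth 0 e i x) f & x < m + eps).
Proof.
move=> rf fx0 fl.
have qeP x := ord.quantifier_elim_rformP (@wf_QE_wproj R) (@valid_QE_wproj R)
  (set_nth 0 e i x) rf.
have /andP[qfq rq] := ord.quantifier_elim_wf (@wf_QE_wproj R) rf.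
have [|x /qeP/fl //|m [m_lb m_inf]] := tame_inf (tame_qf e i qfq rq) (l := l) (x0 := x0).
  by apply/qeP.
exists m; split=> [x /qeP/m_lb //|eps /m_inf[x /qeP fx xm]].
by exists x.
Qed.
End Tame.

(** * First-order definable sets of vectors *)

Section Definable.
Variable R : rcfType.
Implicit Types (P Q : seq R -> Prop) (F G : seq R -> R).

Definition polynomial_fun F :=
  exists2 t, GRing.rterm t & forall e, GRing.eval e t = F e.

(** Working with predicates on environments lets definability be derived from the shape of ordinary
    statements, without writing formulas. *)
Definition definable P :=
  exists2 f, ord.rformula f & forall e, ord.holds e f <-> P e.

Lemma polynomial_var k : polynomial_fun (fun e => e`_k).
Proof. by exists (GRing.Var _ k). Qed.

Lemma polynomial_cst c : polynomial_fun (fun=> c).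
Proof. by exists (GRing.Const c). Qed.

Lemma polynomial_add F G : polynomial_fun F -> polynomial_fun G ->
  polynomial_fun (fun e => F e + G e).
Proof.
move=> [t rt tE] [u ru uE]; exists (GRing.Add t u); rewrite /= ?rt //.
by move=> e; rewrite tE uE.
Qed.

Lemma polynomial_mul F G : polynomial_fun F -> polynomial_fun G ->
  polynomial_fun (fun e => F e * G e).
Proof.
move=> [t rt tE] [u ru uE]; exists (GRing.Mul t u); rewrite /= ?rt //.
by move=> e; rewrite tE uE.
Qed.

Lemma polynomial_sum (I : finType) (F : I -> seq R -> R) :
  (forall i, polynomial_fun (F i)) -> polynomial_fun (fun e => \sum_i F i e).
Proof.
move=> Fpoly; elim: (index_enum I) => [|i r [t rt tE]].
  by have [t rt tE] := polynomial_cst 0; exists t => // e; rewrite big_nil tE.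
have [u ru uE] := polynomial_add (Fpoly i) (ex_intro2 _ _ t rt tE).
by exists u => // e; rewrite big_cons uE.
Qed.

Lemma definable_ext P Q : (forall e, P e <-> Q e) -> definable P -> definable Q.
Proof.
by move=> PQ [f rf fE]; exists f => // e; apply: iff_trans (fE e) (PQ e).
Qed.

Lemma definable_le F G : polynomial_fun F -> polynomial_fun G ->
  definable (fun e => F e <= G e).
Proof.
move=> [t rt tE] [u ru uE]; exists (ord.Le t u); rewrite /= ?rt //.
by move=> e; rewrite tE uE.
Qed.

Lemma definable_and P Q : definable P -> definable Q ->
  definable (fun e => P e /\ Q e).
Proof.
move=> [f rf fE] [g rg gE]; exists (ord.And f g); rewrite /= ?rf //.
by move=> e /=; rewrite fE gE.
Qed.

(** The index type is finite, so this is a conjunction and not a quantifier of the formula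
    language. *)
Lemma definable_forall (I : finType) (P : I -> seq R -> Prop) :
  (forall i, definable (P i)) -> definable (fun e => forall i, P i e).
Proof.
move=> Pdef; suff: definable (fun e => forall i, i \in enum I -> P i e).
  by apply: definable_ext => e; split=> Pe i; [apply: Pe; rewrite mem_enum | ].
elim: (enum I) => [|i r IHr]; first by exists (ord.Bool true).
apply: (definable_ext _ (definable_and (Pdef i) IHr)) => e.
split=> [[Pi Pr] j|Pr].
  by rewrite in_cons => /orP[/eqP->|/Pr].
by split=> [|j jr]; apply: Pr; rewrite in_cons ?eqxx ?jr ?orbT.
Qed.

Lemma definable_exists (ks : seq nat) P : definable P ->
  definable (fun e => exists2 e', (forall k, k \notin ks -> e'`_k = e`_k) & P e').
Proof.
move=> Pdef; elim: ks => [|k ks [f rf fE]].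
  have [f rf fE] := Pdef; exists f => // e; split=> [/fE Pe|[e' ee' Pe']].
    by exists e.
  by apply: (@ord.eq_holds _ e' e) => [k|]; [exact: ee' | exact/fE].
exists (ord.Exists k f) => // e; split=> /=.
  move=> [x /fE[e' ee' Pe']]; exists e' => // j.
  rewrite in_cons negb_or => /andP[jk jks].
  by rewrite ee' // nth_set_nth /= (negPf jk).
move=> [e' ee' Pe']; exists e'`_k; apply/fE; exists e' => // j jks.
rewrite nth_set_nth /=; case: eqVneq => [->//|jk].
by rewrite ee' // in_cons negb_or jk.
Qed.

Lemma definable_coord_inf n (S : 'cV[R]_n -> Prop) i l y0 :
  definable (fun e => S (\col_k e`_k)) -> S y0 -> (forall y, S y -> l <= y i 0) ->
  exists m, (forall y, S y -> m <= y i 0) /\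
    (forall eps, 0 < eps -> exists2 y, S y & y i 0 < m + eps).
Proof.
move=> Sdef Sy0 Sl.
have eq_in : definable (fun e => e`_n <= e`_i /\ e`_i <= e`_n).
  by apply: definable_and; apply: definable_le; apply: polynomial_var.
have [f rf fE] := definable_exists (iota 0 n) (definable_and eq_in Sdef).
pose en x := set_nth 0 [::] n x : seq R.
have fP x : ord.holds (en x) f <-> exists2 y, S y & y i 0 = x.
  split=> [/fE[e' e'n [/andP/le_anti e'i Se']]|[y Sy yix]].
    exists (\col_k e'`_k); rewrite // mxE -e'i e'n ?nth_set_nth /= ?eqxx //.
    by rewrite mem_iota ltnn.
  (* The witness lists the entries of [y] followed by [x]; past index [n] both environments read the
     default 0. *)
  apply/fE; pose e' := rcons [seq y k 0 | k <- enum 'I_n] x.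
  have sz : size [seq y k 0 | k <- enum 'I_n] = n by rewrite size_map size_enum_ord.
  have e'k (k : 'I_n) : e'`_k = y k 0.
    by rewrite nth_rcons sz ltn_ord (nth_map k) ?size_enum_ord // nth_ord_enum.
  have e'n : e'`_n = x by rewrite nth_rcons sz ltnn eqxx.
  exists e'; last first.
    split; first by rewrite e'k e'n yix.
    by have -> : \col_k e'`_k = y by apply/colP => k; rewrite mxE e'k.
  move=> k; rewrite mem_iota /= -leqNgt leq_eqVlt nth_set_nth /= eq_sym.
  case: eqVneq => [->|nk /= lenk]; first by rewrite e'n.
  by rewrite nth_nil nth_default // size_rcons sz.
have [||m [m_lb m_inf]] := definable_inf (e := [::]) (i := n) (l := l) (x0 := y0 i 0) rf.
- by apply/fP; exists y0.
- by move=> x /fP[y Sy <-]; apply: Sl.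
exists m; split=> [y Sy|eps /m_inf[x /fP[y Sy <-] yim]].
  by apply/m_lb/fP; exists y.
by exists y.
Qed.
End Definable.

(** * Z-matrices *)

Definition lemx (R : realFieldType) m p (A B : 'M[R]_(m, p)) : Prop :=
  forall i j, A i j <= B i j.
Local Notation "A <=m B" := (lemx A B) (at level 70).

Section Nonneg.
Variable R : realFieldType.

Definition Zmx n (A : 'M[R]_n) := forall i j, i != j -> A i j <= 0.

(* The matrix of [y |-> b (y, x)], so that [b (y, x) = bmx B x *m y]. *)
Definition bmx n (B : 'I_n -> 'I_n -> 'I_n -> R) (x : 'cV[R]_n) : 'M[R]_n :=
  \matrix_(i, j) \sum_k B i j k * x k 0.

Lemma lemx_refl m p (A : 'M[R]_(m, p)) : A <=m A.
Proof. by move=> i j. Qed.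

Lemma lemx_trans m p (A B D : 'M[R]_(m, p)) : A <=m B -> B <=m D -> A <=m D.
Proof. by move=> AB BD i j; apply: le_trans (AB i j) (BD i j). Qed.

Lemma subrmx_ge0 m p (A B : 'M[R]_(m, p)) : (0 <=m B - A) <-> (A <=m B).
Proof.
by split=> AB i j; have := AB i j; rewrite !mxE subr_ge0.
Qed.

Lemma addmx_ge0 m p (A B : 'M[R]_(m, p)) : 0 <=m A -> 0 <=m B -> 0 <=m A + B.
Proof.
by move=> A0 B0 i j; have := (A0 i j); have := (B0 i j); rewrite !mxE => *; apply: addr_ge0.
Qed.

Lemma mulmx_ge0 m p q (A : 'M[R]_(m, p)) (B : 'M[R]_(p, q)) :
  0 <=m A -> 0 <=m B -> 0 <=m A *m B.
Proof.
move=> A0 B0 i j; rewrite !mxE; apply: sumr_ge0 => k _.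
by have := A0 i k; have := B0 k j; rewrite !mxE => *; apply: mulr_ge0.
Qed.

Lemma lemx_mull m p q (A B : 'M[R]_(m, p)) (D : 'M[R]_(p, q)) :
  0 <=m D -> A <=m B -> A *m D <=m B *m D.
Proof.
move=> D0 /subrmx_ge0 AB; apply/subrmx_ge0; rewrite -mulmxBl; exact: mulmx_ge0.
Qed.

Lemma lemx_mulr m p q (A B : 'M[R]_(p, q)) (D : 'M[R]_(m, p)) :
  0 <=m D -> A <=m B -> D *m A <=m D *m B.
Proof.
move=> D0 /subrmx_ge0 AB; apply/subrmx_ge0; rewrite -mulmxBr; exact: mulmx_ge0.
Qed.

Section Tensor.
Variables (n : nat) (B : 'I_n -> 'I_n -> 'I_n -> R).
Hypothesis B_ge0 : forall i j k, 0 <= B i j k.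
Implicit Types x y : 'cV[R]_n.

Lemma bmxB x y : bmx B (x - y) = bmx B x - bmx B y.
Proof.
apply/matrixP => i j; rewrite !mxE -sumrB; apply: eq_bigr => k _.
by rewrite !mxE mulrBr.
Qed.

Lemma bmx_ge0 x : 0 <=m x -> 0 <=m bmx B x.
Proof.
move=> x0 i j; rewrite !mxE; apply: sumr_ge0 => k _; apply: mulr_ge0 => //.
by have := x0 k 0; rewrite mxE.
Qed.

Lemma lemx_bmx x y : x <=m y -> bmx B x <=m bmx B y.
Proof. by move=> /subrmx_ge0 xy; apply/subrmx_ge0; rewrite -bmxB; apply: bmx_ge0. Qed.

Lemma lemx_quad x y : 0 <=m x -> x <=m y -> bmx B x *m x <=m bmx B y *m y.
Proof.
move=> x0 xy; apply: (lemx_trans (lemx_mull x0 (lemx_bmx xy))).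
by apply: (lemx_mulr _ xy); apply: bmx_ge0; apply: lemx_trans xy.
Qed.
End Tensor.

(** Off-diagonal entries are nonpositive, so only the diagonal term can raise row [i]. *)
Lemma Zmx_row n (M : 'M[R]_n) (w y : 'cV[R]_n) i : Zmx M -> w <=m y ->
  (M *m y) i 0 <= (M *m w) i 0 + M i i * (y i 0 - w i 0).
Proof.
move=> MZ wy; rewrite -lerBlDl !mxE -sumrB (bigD1 i) //= -mulrBr gerDl.
apply: sumr_le0 => j ji; rewrite -mulrBr mulr_le0_ge0 ?subr_ge0 //.
by apply: MZ; rewrite eq_sym.
Qed.

(** Equivalent to being invertible with nonnegative inverse, but stated without the inverse. *)
Definition monotone_mx n (A : 'M[R]_n) :=
  forall v : 'cV[R]_n, 0 <=m A *m v -> 0 <=m v.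

(** A kernel vector and its opposite are both nonnegative, hence zero; the columns of [cokermx A]
    are kernel vectors. *)
Lemma monotone_unit n (A : 'M[R]_n) : monotone_mx A -> A \in unitmx.
Proof.
move=> A_mono; rewrite -row_full_unit -cokermx_eq0; apply/eqP/matrixP => i j.
set v := col j (cokermx A).
have Av : A *m v = 0 by rewrite /v !colE mulmxA mulmx_coker mul0mx.
have v0 : 0 <=m v by apply: A_mono; rewrite Av; apply: lemx_refl.
have v1 : 0 <=m - v by apply: A_mono; rewrite mulmxN Av oppr0; apply: lemx_refl.
apply/le_anti/andP; have := v0 i 0; have := v1 i 0; rewrite !mxE oppr_ge0.
by move=> -> ->.
Qed.

Lemma monotone_ge0 n (A : 'M[R]_n) (v : 'cV[R]_n) :
  monotone_mx A -> 0 <=m v -> 0 <=m invmx A *m v.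
Proof.
by move=> A_mono v0; apply: (A_mono); rewrite mulKVmx // monotone_unit.
Qed.

(* [c] is the least ratio [v i / x i]; if it is negative, the indices at which
   it is attained contradict the hypothesis. *)
Lemma Zmx_monotone n (A : 'M[R]_n) (x : 'cV[R]_n) :
  Zmx A -> (forall i, 0 < x i 0) -> 0 <=m A *m x ->
  (forall I : pred 'I_n, (exists i, I i) -> (forall i, I i -> (A *m x) i 0 = 0) ->
    exists i j, [/\ I i, ~~ I j & A i j != 0]) ->
  monotone_mx A.
Proof.
move=> AZ x0 Ax0 hI v Av0 i0 j0; rewrite mxE leNgt ord1; apply/negP => vi0.
pose r i := v i 0 / x i 0.
have [i1 _ /= r_min] := @Order.TotalTheory.arg_minP _ _ _ i0 predT r isT.
set c := r i1 in r_min.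
have c_lt0 : c < 0 by rewrite (le_lt_trans (r_min i0 isT)) // pmulr_llt0 ?invr_gt0.
pose w := v - c *: x.
have wE j : w j 0 = v j 0 - c * x j 0 by rewrite !mxE.
have w_ge0 j : 0 <= w j 0.
  by rewrite wE subr_ge0 -ler_pdivlMr // r_min.
have AwE i : (A *m w) i 0 = (A *m v) i 0 - c * (A *m x) i 0.
  by rewrite mulmxBr -scalemxAr !mxE.
have w0 i : r i = c -> w i 0 = 0 by move=> ri; rewrite wE -ri divfK ?subrr // gt_eqF.
(* As [w] vanishes at [i], every term of row [i] is nonpositive, so the row is at most any one of
   its terms. *)
have Aw_le i j : r i = c -> (A *m w) i 0 <= A i j * w j 0.
  move=> ri; rewrite mxE (bigD1 j) //= gerDl; apply: sumr_le0 => k _.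
  have [<-|ik] := eqVneq i k; first by rewrite w0 // mulr0.
  by rewrite mulr_le0_ge0 // AZ.
have Av_ge0 i : 0 <= (A *m v) i 0 by have := Av0 i 0; rewrite [X in X <= _]mxE.
have Ax_ge0 i : 0 <= (A *m x) i 0 by have := Ax0 i 0; rewrite [X in X <= _]mxE.
(* Where the minimum is attained, (A w)_i <= 0 while (A v)_i >= 0 and c < 0, which forces (A x)_i =
   0. *)
have [|i /eqP ri|i [j [/eqP ri rj Aij]]] := hI (fun i => r i == c).
- by exists i1.
- apply/le_anti; rewrite Ax_ge0 andbT -(nmulr_rge0 _ c_lt0).
  have := Aw_le i i ri; rewrite w0 // mulr0 AwE subr_le0.
  exact: le_trans.
have wj : 0 < w j 0.
  rewrite lt_def w_ge0 andbT wE subr_eq0; apply: contraNneq rj => vj.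
  by rewrite /r vj mulfK // gt_eqF.
have ij : i != j by apply: contraNneq rj => <-; rewrite ri.
have := Aw_le i j ri; rewrite leNgt => /negP[].
apply: (@lt_le_trans _ _ 0); first by rewrite pmulr_llt0 // lt_neqAle Aij AZ.
by rewrite AwE subr_ge0 (le_trans _ (Av_ge0 i)) // mulr_le0_ge0 // ltW.
Qed.
End Nonneg.

(** * The quadratic equation over a real closed field *)

Section Equation.
Variables (R : rcfType) (n : nat) (M : 'M[R]_n) (a : 'cV[R]_n).
Variable (B : 'I_n -> 'I_n -> 'I_n -> R).
Hypothesis M_Z : Zmx M.
Hypothesis a_ge0 : 0 <=m a.
Hypothesis B_ge0 : forall i j k, 0 <= B i j k.

Definition supersolution (y : 'cV[R]_n) := a + bmx B y *m y <=m M *m y.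

(* The componentwise infimum of the supersolutions in [0, z] is again one,
   and it is a solution since a strict row would allow decreasing the
   corresponding component. *)
Lemma solution_below z : 0 <=m z -> supersolution z ->
  exists y, [/\ 0 <=m y, y <=m z & M *m y = a + bmx B y *m y].
Proof.
move=> z0 z_super; pose S y := [/\ 0 <=m y, y <=m z & supersolution y].
(* [S] is cut out by finitely many polynomial inequalities in the entries. *)
have Sdef : definable (fun e : seq R => S (\col_k e`_k)).
  apply: (@definable_ext _ (fun e => forall i : 'I_n,
      (0 <= e`_i /\ e`_i <= z i 0) /\
      a i 0 + \sum_j (\sum_k B i j k * e`_k) * e`_j <= \sum_j M i j * e`_j)).
    move=> e; pose y : 'cV[R]_n := \col_k e`_k.
    have yE k : y k 0 = e`_k by rewrite mxE.
    have lhsE i : (a + bmx B y *m y) i 0 =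
        a i 0 + \sum_j (\sum_k B i j k * e`_k) * e`_j.
      rewrite !mxE; congr (_ + _); apply: eq_bigr => j _; rewrite !mxE.
      by congr (_ * _); apply: eq_bigr => k _; rewrite mxE.
    have rhsE i : (M *m y) i 0 = \sum_j M i j * e`_j.
      by rewrite mxE; apply: eq_bigr => j _; rewrite mxE.
    split=> [He|[y0 yz ysup] i].
      split=> i j; have [[ei0 eiz] sup_i] := He i; rewrite ord1.
      - by rewrite yE mxE.
      - by rewrite yE.
      by rewrite lhsE rhsE.
    have := y0 i 0; have := yz i 0; have := ysup i 0.
    by rewrite lhsE rhsE yE mxE.
  apply: definable_forall => i; do ?apply: definable_and; apply: definable_le;
    do ?[exact: polynomial_cst | exact: polynomial_var | apply: polynomial_add
        | apply: polynomial_sum => ? | apply: polynomial_mul].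
(* Row [i] of the minimum is compared with whichever of [y], [y'] attains it at [i], where the
   diagonal term of [Zmx_row] vanishes. *)
have S_min y y' : S y -> S y' -> S (\col_k Num.min (y k 0) (y' k 0)).
  move=> [y0 yz ysup] [y'0 y'z y'sup]; set w := \col_k _.
  have w0 : 0 <=m w.
    by move=> i j; have := y0 i j; have := y'0 i j; rewrite !mxE ord1 le_min => -> ->.
  have wy : w <=m y by move=> i j; rewrite !mxE ord1 ge_min lexx.
  have wy' : w <=m y' by move=> i j; rewrite !mxE ord1 ge_min lexx orbT.
  split=> //; first exact: lemx_trans wy yz.
  have row u i : w <=m u -> supersolution u -> w i 0 = u i 0 ->
      (a + bmx B w *m w) i 0 <= (M *m w) i 0.
    move=> wu usup wi; have := Zmx_row i M_Z wu.
    rewrite wi subrr mulr0 addr0; apply: le_trans.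
    apply: le_trans (usup i 0); rewrite !mxE lerD2l.
    by have := lemx_quad B_ge0 w0 wu i 0; rewrite !mxE.
  move=> i j; rewrite ord1.
  have wi : w i 0 = Num.min (y i 0) (y' i 0) by rewrite mxE.
  have [yy'|/ltW y'y] := leP (y i 0) (y' i 0).
    by apply: (row y) => //; rewrite wi (min_idPl yy').
  by apply: (row y') => //; rewrite wi (min_idPr y'y).
have Sz : S z by split=> //; apply: lemx_refl.
have coord_inf (i : 'I_n) : exists m, (forall y, S y -> m <= y i 0) /\
    (forall eps, 0 < eps -> exists2 y, S y & y i 0 < m + eps).
  apply: (definable_coord_inf (l := 0) Sdef Sz) => y [y0 _ _].
  by have := y0 i 0; rewrite mxE.
have [f fP] := fin_all_exists coord_inf; pose m := \col_k f k.
have m_lb y : S y -> m <=m y.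
  by move=> Sy i j; rewrite mxE ord1; have [H _] := fP i; apply: H.
(* Stability under minima gives one element of [S] close to [m] in all coordinates
   simultaneously. *)
have m_inf eps : 0 < eps -> exists2 y, S y & forall i, y i 0 <= m i 0 + eps.
  move=> eps0; suff [y Sy ym] : exists2 y, S y & forall i, i \in enum 'I_n -> y i 0 <= m i 0 + eps.
    by exists y => // i; rewrite ym ?mem_enum.
  elim: (enum 'I_n) => [|i r [y Sy ym]]; first by exists z.
  have [_ /(_ _ eps0)[y' Sy' y'm]] := fP i.
  exists (\col_k Num.min (y k 0) (y' k 0)); first exact: S_min.
  move=> j; rewrite in_cons !mxE ge_min => /orP[/eqP->|/ym]; rewrite ?mxE.
    by rewrite (ltW y'm) orbT.
  by move=> ->.
have m0 : 0 <=m m.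
  move=> i j; rewrite [X in X <= _]mxE ord1.
  apply/ler_addgt0Pr => eps /m_inf[y [y0 _ _] ym].
  by apply: le_trans (ym i); have := y0 i 0; rewrite mxE.
have m_super : supersolution m.
  move=> i j; rewrite ord1; apply/ler_addgt0Pr => d d0.
  (* Passing from [m] to [y] raises row [i] by at most |M_ii| times the distance, so a distance of d
     / (|M_ii| + 1) costs at most [d]; the 1 keeps the denominator positive. *)
  have c0 : 0 < `|M i i| + 1 by rewrite ltr_wpDl.
  have [y Sy ym] := m_inf _ (divr_gt0 d0 c0); have [y0 _ ysup] := Sy.
  have my := m_lb y Sy.
  apply: (@le_trans _ _ ((M *m y) i 0)).
    apply: le_trans (ysup i 0); rewrite !mxE lerD2l.
    by have := lemx_quad B_ge0 m0 my i 0; rewrite !mxE.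
  apply: le_trans (Zmx_row i M_Z my) _; rewrite lerD2l.
  have ymi0 : 0 <= y i 0 - m i 0 by rewrite subr_ge0.
  apply: (@le_trans _ _ (`|M i i| * (y i 0 - m i 0))).
    by rewrite ler_wpM2r // ler_norm.
  apply: (@le_trans _ _ ((`|M i i| + 1) * (d / (`|M i i| + 1)))).
    by rewrite ler_pM // ?lerDl // lerBlDl.
  by rewrite mulrC divfK // gt_eqF.
have Sm : S m by split=> //; apply: m_lb.
exists m; split=> //; first exact: m_lb.
apply/colP => i; apply/le_anti; rewrite m_super andbT leNgt; apply/negP.
set d := _ i 0 => dlt; set d' := (M *m m) i 0 in dlt.
have bm0 : 0 <=m a + bmx B m *m m.
  by apply: addmx_ge0 => //; apply: mulmx_ge0 => //; apply: bmx_ge0.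
(* If m_i were 0, the sign pattern of [M] would give (M m)_i <= 0 <= d, and the row would not be
   strict. *)
have mi0 : 0 < m i 0.
  rewrite lt_def; have := m0 i 0; rewrite [X in X <= _]mxE => ->.
  rewrite andbT; apply: contraTneq dlt => mi; rewrite -leNgt.
  apply: (@le_trans _ _ 0); last by have := bm0 i 0; rewrite [X in X <= _]mxE.
  rewrite /d' mxE; apply: sumr_le0 => j _; have [<-|ij] := eqVneq i j.
    by rewrite mi mulr0.
  by rewrite mulr_le0_ge0 ?M_Z //; have := m0 j 0; rewrite [X in X <= _]mxE.
have c0 : 0 < `|M i i| + 1 by rewrite ltr_wpDl.
(* Lowering component [i] by [t] keeps it nonnegative and keeps row [i] at least [d]; the other rows
   do not decrease because M_ki <= 0. *)
pose t := Num.min (m i 0) ((d' - d) / (`|M i i| + 1)).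
have t0 : 0 < t by rewrite lt_min mi0 divr_gt0 // subr_gt0.
pose y := m - t *: delta_mx i 0 : 'cV_n.
have yE k : y k 0 = m k 0 - t * (k == i)%:R by rewrite !mxE eqxx andbT.
have y0 : 0 <=m y.
  move=> k j; rewrite ord1 yE [X in X <= _]mxE; have := m0 k 0; rewrite [X in X <= _]mxE.
  by case: eqP => [->|_]; rewrite ?mulr0 ?subr0 // mulr1 subr_ge0 ge_min lexx.
have ym : y <=m m.
  by move=> k j; rewrite ord1 yE gerBl mulr_ge0 ?ler0n // ltW.
have ysup : supersolution y.
  move=> k j; rewrite ord1 {j}.
  apply: (@le_trans _ _ ((a + bmx B m *m m) k 0)).
    by rewrite !mxE lerD2l; have := lemx_quad B_ge0 y0 ym k 0; rewrite !mxE.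
  have -> : (M *m y) k 0 = (M *m m) k 0 - t * M k i.
    by rewrite /y mulmxBr -scalemxAr -colE !mxE.
  have [->|ki] := eqVneq k i; last first.
    rewrite (le_trans (m_super k 0)) // lerDl oppr_ge0.
    by rewrite mulr_ge0_le0 ?M_Z // ltW.
  rewrite -/d -/d' lerBrDl addrC -lerBrDl.
  apply: (@le_trans _ _ (t * (`|M i i| + 1))).
    by rewrite ler_pM2l // (le_trans (ler_norm _)) ?lerDl.
  by rewrite -ler_pdivlMr // ge_min lexx orbT.
have : m <=m y by apply: (m_lb); split=> //; apply: lemx_trans ym (m_lb z Sz).
by move=> /(_ i 0); rewrite yE eqxx mulr1 lerDl oppr_ge0 leNgt t0.
Qed.
End Equation.

(** * Monotone matrices above M - b(., xs) *)

Section Comparison.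
Variables (R : rcfType) (n : nat) (M : 'M[R]_n) (a : 'cV[R]_n).
Variable (B : 'I_n -> 'I_n -> 'I_n -> R).
Hypothesis M_Z : Zmx M.
Hypothesis a_ge0 : 0 <=m a.
Hypothesis B_ge0 : forall i j k, 0 <= B i j k.
Variable xs : 'cV[R]_n.
Hypothesis xs_gt0 : forall i, 0 < xs i 0.
Hypothesis xs_sol : M *m xs = a + bmx B xs *m xs.
Hypothesis xs_min : forall y, 0 <=m y -> M *m y = a + bmx B y *m y -> xs <=m y.

Local Notation A := (M - bmx B xs).

Let xs_ge0 : 0 <=m xs.
Proof. by move=> i j; rewrite mxE ord1 ltW. Qed.

Let A_xs : A *m xs = a.
Proof. by rewrite mulmxBl xs_sol addrK. Qed.

Let Zmx_sub_bmx (N : 'M[R]_n) (B' : 'I_n -> 'I_n -> 'I_n -> R) x :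
  Zmx N -> (forall i j k, 0 <= B' i j k) -> 0 <=m x -> Zmx (N - bmx B' x).
Proof.
move=> NZ B'0 x0 i j ij; rewrite [_ i j]mxE [X in _ + X]mxE subr_le0.
by rewrite (le_trans (NZ i j ij)) //; have := bmx_ge0 B'0 x0 i j; rewrite [X in X <= _]mxE.
Qed.

(* A set of rows where [A] is block triangular and [a] vanishes would give a
   supersolution, hence a solution, vanishing on that set. *)
Lemma critical_rows (I : pred 'I_n) : (exists i, I i) ->
  (forall i, I i -> a i 0 = 0) -> exists i j, [/\ I i, ~~ I j & A i j != 0].
Proof.
move=> [i0 Ii0] aI0.
have [/existsP[i /existsP[j /and3P[? ? ?]]]|noij] :=
  boolP [exists i, exists j, [&& I i, ~~ I j & A i j != 0]]; first by exists i, j.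
(* A_ij = 0 equates M_ij <= 0 with an entry of b(., xs) that is >= 0, so both vanish; positivity of
   [xs] then kills each coefficient. *)
have AIJ i j : I i -> ~~ I j -> M i j = 0 /\ forall k, B i j k = 0.
  move=> Ii Ij; have ij : i != j by apply: contraNneq Ij => <-.
  move: noij; rewrite negb_exists => /forallP/(_ i); rewrite negb_exists.
  move=> /forallP/(_ j); rewrite Ii Ij /= negbK mxE [X in _ + X]mxE subr_eq0.
  move=> /eqP MB; have b0 : bmx B xs i j = 0.
    apply/le_anti; rewrite -{1}MB M_Z //=.
    by have := bmx_ge0 B_ge0 xs_ge0 i j; rewrite [X in X <= _]mxE.
  rewrite MB b0; split=> // k; move/eqP: b0; rewrite mxE psumr_eq0; last first.
    by move=> l _; rewrite mulr_ge0 // ltW.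
  by move=> /allP/(_ k (mem_index_enum _)) /=; rewrite mulf_eq0 (gt_eqF (xs_gt0 k)) orbF => /eqP.
pose z := \col_k if I k then 0 else xs k 0.
have zxs : z <=m xs by move=> k j; rewrite mxE ord1; case: (I k) => //; apply: ltW.
have z0 : 0 <=m z.
  by move=> k j; rewrite !mxE; case: (I k) => //; apply: ltW.
(* On rows in [I] both sides are 0; on the others [z] agrees with [xs] at the diagonal, so M z >= M
   xs there by [Zmx_row]. *)
have zsup : supersolution M a B z.
  move=> i j; rewrite ord1 {j}; have [Ii|nIi] := boolP (I i).
    rewrite [leLHS]mxE aI0 // !mxE add0r !big1 // => j _.
      by rewrite !mxE; case: ifPn => [_|Ij]; rewrite ?mulr0 // (AIJ i j Ii Ij).1 mul0r.
    rewrite !mxE; case: ifPn => [_|Ij]; rewrite ?mulr0 // big1 ?mul0r // => k _.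
    by rewrite (AIJ i j Ii Ij).2 mul0r.
  have := Zmx_row i M_Z zxs; rewrite [z i 0]mxE (negPf nIi) subrr mulr0 addr0.
  apply: le_trans; rewrite xs_sol !mxE lerD2l.
  by have := lemx_quad B_ge0 z0 zxs i 0; rewrite !mxE.
have [y [y0 yz ysol]] := solution_below M_Z a_ge0 B_ge0 z0 zsup.
have := le_trans (xs_min y0 ysol i0 0) (yz i0 0).
by rewrite [z _ _]mxE Ii0 leNgt xs_gt0.
Qed.

(** A' xs >= A xs = a >= 0. Where A' xs vanishes, so does [a], and the rows of A' and A coincide
    since xs > 0; [critical_rows] then supplies the entry required by [Zmx_monotone]. *)
Lemma monotone_above (A' : 'M[R]_n) : Zmx A' -> A <=m A' -> monotone_mx A'.
Proof.
move=> A'Z AA'; have AA'xs := lemx_mull xs_ge0 AA'.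
apply: (Zmx_monotone A'Z xs_gt0).
  by apply: lemx_trans AA'xs; rewrite A_xs.
move=> I Ine A'I; have axs i : I i -> a i 0 = 0.
  move=> Ii; apply/le_anti; have := AA'xs i 0; rewrite A_xs A'I // => ->.
  by have := a_ge0 i 0; rewrite mxE.
have [i [j [Ii Ij Aij]]] := critical_rows Ine axs.
exists i, j; split=> //; suff -> : A' i j = A i j by [].
have /eqP : ((A' - A) *m xs) i 0 = 0.
  by rewrite mulmxBl A_xs [LHS]mxE [X in _ + X]mxE A'I // axs // subrr.
rewrite mxE psumr_eq0 => [/allP/(_ j (mem_index_enum _)) /=|k _].
  by rewrite !mxE mulf_eq0 (gt_eqF (xs_gt0 j)) orbF subr_eq0 => /eqP.
by rewrite mulr_ge0 ?(ltW (xs_gt0 k)) // !mxE subr_ge0; have := AA' i k; rewrite !mxE.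
Qed.

(** * Splittings and comparison of the two iterations *)

Variables (B1 B2 : 'I_n -> 'I_n -> 'I_n -> R) (N P : 'M[R]_n).
Hypothesis B1_ge0 : forall i j k, 0 <= B1 i j k.
Hypothesis B2_ge0 : forall i j k, 0 <= B2 i j k.
Hypothesis B_split : forall i j k, B i j k = B1 i j k + B2 i j k.
Hypothesis N_Z : Zmx N.
Hypothesis P_ge0 : 0 <=m P.
Hypothesis M_split : M = N - P.

Definition split_map x := invmx (N - bmx B1 x) *m (a + P *m x + bmx B2 x *m x).
Definition full_map x := invmx (M - bmx B x) *m a.

Let bmx_split x : bmx B x = bmx B1 x + bmx B2 x.
Proof.
apply/matrixP => i j; rewrite !mxE -big_split; apply: eq_bigr => k _.
by rewrite B_split mulrDl.
Qed.

Let addmxE m p (U V : 'M[R]_(m, p)) i j : (U + V) i j = U i j + V i j.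
Proof. by rewrite mxE. Qed.

Let oppmxE m p (U : 'M[R]_(m, p)) i j : (- U) i j = - U i j.
Proof. by rewrite mxE. Qed.

(** Expands both splittings down to entries of products, in which the remaining inequalities are
    linear and within reach of [lra]. *)
Let entryE := (mulmxBl, mulmxDl, mulmxBr, mulmxDr, bmx_split, M_split, addmxE, oppmxE).

Let monotone_g x : 0 <=m x -> x <=m xs -> monotone_mx (M - bmx B x).
Proof.
move=> x0 xxs; apply: monotone_above; first exact: Zmx_sub_bmx.
move=> i j; rewrite !addmxE !oppmxE lerD2l lerN2; exact: lemx_bmx.
Qed.

(** The difference with A is P + b1(., xs - x) + b2(., xs) >= 0. *)
Let monotone_f x : 0 <=m x -> x <=m xs -> monotone_mx (N - bmx B1 x).
Proof.
move=> x0 xxs; apply: monotone_above; first exact: Zmx_sub_bmx.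
move=> i j; rewrite !entryE.
have := lemx_bmx B1_ge0 xxs i j; have := bmx_ge0 B2_ge0 xs_ge0 i j.
by have := P_ge0 i j; rewrite !(mxE _ (fun _ _ => 0)); lra.
Qed.

Definition subsolution x := [/\ 0 <=m x, x <=m xs & M *m x <=m a + bmx B x *m x].

Lemma split_map_step x : subsolution x -> subsolution (split_map x) /\ split_map x <=m full_map x.
Proof.
move=> [x0 xxs xsub]; have fmono := monotone_f x0 xxs.
have gmono := monotone_g x0 xxs.
set y := split_map x; have yE : N *m y - bmx B1 x *m y = a + P *m x + bmx B2 x *m x.
  by rewrite -mulmxBl mulKVmx // monotone_unit.
have {}yE i : (N *m y) i 0 - (bmx B1 x *m y) i 0 =
    a i 0 + (P *m x) i 0 + (bmx B2 x *m x) i 0.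
  by have /matrixP/(_ i 0) := yE; rewrite !entryE.
(* J(x)(y - x) = - F(x) >= 0. *)
have xy : x <=m y.
  apply/subrmx_ge0/fmono => i j; rewrite ord1 {j} !entryE mxE.
  by have := yE i; have := xsub i 0; rewrite !entryE; lra.
(* J(x)(xs - y) = P(xs - x) + b1(xs, xs - x) + b2(xs, xs) - b2(x, x) >= 0. *)
have yxs : y <=m xs.
  apply/subrmx_ge0/fmono => i j; rewrite ord1 {j} !entryE mxE.
  have := yE i; have /matrixP/(_ i 0) := xs_sol; rewrite !entryE.
  have := lemx_mulr P_ge0 xxs i 0; have := lemx_quad B2_ge0 x0 xxs i 0.
  by have := lemx_mull xs_ge0 (lemx_bmx B1_ge0 xxs) i 0; lra.
have y0 : 0 <=m y by apply: lemx_trans xy.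
split; first split=> //.
  (* - F(y) = P(y - x) + b1(y, y - x) + b2(y, y) - b2(x, x) >= 0. *)
  move=> i j; rewrite ord1 {j} !entryE; have := yE i.
  have := lemx_mulr P_ge0 xy i 0; have := lemx_quad B2_ge0 x0 xy i 0.
  by have := lemx_mull y0 (lemx_bmx B1_ge0 xy) i 0; lra.
have gE : (M - bmx B x) *m full_map x = a by rewrite mulKVmx // monotone_unit.
(* Applying M - b(., x) to fhat(x) - y gives P(y - x) + b2(y - x, x) >= 0. *)
apply/subrmx_ge0/gmono => i j; rewrite mulmxBr gE ord1 {j} !entryE mxE.
have := yE i; have := lemx_mulr P_ge0 xy i 0.
by have := lemx_mulr (bmx_ge0 B2_ge0 x0) xy i 0; lra.
Qed.

(** Applying M - b(., y) to fhat(y) - fhat(x) gives b(fhat(x), y - x), nonnegative because fhat(x)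
    >= 0. *)
Lemma full_map_homo x y : 0 <=m x -> x <=m y -> y <=m xs -> full_map x <=m full_map y.
Proof.
move=> x0 xy yxs; have xxs := lemx_trans xy yxs; have y0 := lemx_trans x0 xy.
have gx0 : 0 <=m full_map x by apply: monotone_ge0 => //; apply: monotone_g.
have gE u : 0 <=m u -> u <=m xs -> M *m full_map u - bmx B u *m full_map u = a.
  by move=> u0 uxs; rewrite -mulmxBl mulKVmx // monotone_unit //; apply: monotone_g.
apply/subrmx_ge0/(monotone_g y0 yxs) => i j; rewrite ord1 {j} [X in X <= _]mxE.
have /matrixP/(_ i 0) := gE x x0 xxs; have /matrixP/(_ i 0) := gE y y0 yxs.
have := lemx_mull gx0 (lemx_bmx B_ge0 xy) i 0.
by rewrite !entryE; lra.
Qed.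

Lemma full_map_xs : full_map xs = xs.
Proof. by rewrite /full_map -A_xs mulKmx // monotone_unit //; apply: monotone_g (lemx_refl _). Qed.

(** With u and w the k-th iterates, f(u) <= fhat(u) <= fhat(w). The induction also carries w <= xs,
    which monotonicity of fhat needs and which persists because fhat fixes [xs]. *)
Lemma iter_split_le_full x k : subsolution x -> iter k split_map x <=m iter k full_map x.
Proof.
move=> xsub; suff [] : [/\ subsolution (iter k split_map x),
    iter k split_map x <=m iter k full_map x & iter k full_map x <=m xs] by [].
elim: k => [|k [fsub fg gxs]]; first by have [] := xsub; split=> //; exact: lemx_refl.
have [f0 fxs _] := fsub; have [fsub' fg'] := split_map_step fsub.
split=> //=; first by apply: lemx_trans fg' _; apply: full_map_homo.
by rewrite -[xs]full_map_xs; apply: full_map_homo; rewrite ?full_map_xs //; apply: lemx_trans fg.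
Qed.
End Comparison.

(** * Transfer to [C] *)

Local Notation embed := (map_mx (@realsub_val _)).

Section Transfer.
Variables (C : numClosedFieldType) (n : nat).
Local Notation R := (realsub C).

Lemma realmx_lift m p (A : 'M[C]_(m, p)) : Defs.realmx A -> exists A' : 'M[R]_(m, p), A = embed A'.
Proof.
move=> A_real; exists (\matrix_(i, j) RealSub (A_real i j)).
by apply/matrixP => i j; rewrite !mxE.
Qed.

Lemma real_tensor_lift (B : tensor C n) : real_tensor B ->
  exists B' : 'I_n -> 'I_n -> 'I_n -> R, forall i j k, B i j k = realsub_val (B' i j k).
Proof. by move=> B_real; exists (fun i j k => RealSub (B_real i j k)). Qed.

Lemma mxle0_real m p (A : 'M[C]_(m, p)) : mxle 0 A -> Defs.realmx A.
Proof. by move=> A0 i j; have := A0 i j; rewrite mxE; apply: ger0_real. Qed.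

Lemma mxle_embed m p (A B : 'M[R]_(m, p)) : mxle (embed A) (embed B) <-> lemx A B.
Proof. by split=> AB i j; have := AB i j; rewrite !mxE. Qed.

Lemma Mmatrix_lift (A : 'M[C]_n) : Mmatrix A -> exists2 A' : 'M[R]_n, A = embed A' & Zmx A'.
Proof.
move=> [s [P [s_real [P0 [_ AE]]]]].
have [|A' A'E] := @realmx_lift _ _ A.
  move=> i j; rewrite AE !mxE rpredB ?rpredMn //; exact: mxle0_real.
exists A' => // i j ij; change (realsub_val (A' i j) <= 0).
have -> : realsub_val (A' i j) = A i j by rewrite A'E mxE.
by rewrite AE !mxE (negPf ij) mulr0n sub0r oppr_le0; have := P0 i j; rewrite mxE.
Qed.

(** The coefficient is component [i] of b evaluated at the basis vectors e_j and e_k. *)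
Lemma nonneg_bil_coef (B : tensor C n) i j k : nonneg_bil B -> 0 <= B i j k.
Proof.
move=> B0; have delta0 l : mxle 0 (delta_mx l 0 : 'cV[C]_n).
  by move=> p q; rewrite !mxE; apply: ler0n.
have := B0 _ _ (delta0 j) (delta0 k) i 0; rewrite !mxE.
rewrite (bigD1 j) //= (bigD1 k) //= !mxE !eqxx !mulr1.
rewrite big1 ?addr0 => [|l lk]; last by rewrite !mxE (negPf lk) mulr0.
rewrite big1 ?addr0 // => l lj; apply: big1 => q _.
by rewrite !mxE (negPf lj) mulr0 mul0r.
Qed.

Lemma bil_bilR (B : tensor C n) x y : bil B x y = bilR B y *m x.
Proof.
apply/colP => i; rewrite !mxE; apply: eq_bigr => j _.
by rewrite !mxE mulr_suml; apply: eq_bigr => k _; rewrite mulrAC.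
Qed.

Lemma bilR_embed (B : tensor C n) (B' : 'I_n -> 'I_n -> 'I_n -> R) x :
  (forall i j k, B i j k = realsub_val (B' i j k)) ->
  bilR B (embed x) = embed (bmx B' x).
Proof.
move=> BB'; apply/matrixP => i j; rewrite !mxE rmorph_sum; apply: eq_bigr => k _.
by rewrite BB' mxE rmorphM.
Qed.

Lemma bil_embed (B : tensor C n) (B' : 'I_n -> 'I_n -> 'I_n -> R) x y :
  (forall i j k, B i j k = realsub_val (B' i j k)) ->
  bil B (embed x) (embed y) = embed (bmx B' y *m x).
Proof. by move=> BB'; rewrite bil_bilR (bilR_embed _ BB') map_mxM. Qed.
End Transfer.

Theorem mainTheorem10 (C : numClosedFieldType) (n : nat)
  (M : 'M[C]_n) (a : 'cV[C]_n) (B : tensor C n) (xs : 'cV[C]_n)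
  (B1 B2 : tensor C n) (N P : 'M[C]_n) :
  nonsingular_Mmatrix M ->
  mxle 0 a ->
  real_tensor B -> nonneg_bil B ->
  hypH M a B xs ->
  real_tensor B1 -> real_tensor B2 ->
  nonneg_bil B1 -> nonneg_bil B2 ->
  (forall i j k, B i j k = B1 i j k + B2 i j k) ->
  Mmatrix N -> mxle 0 P -> M = N - P ->
  forall x : 'cV[C]_n, mxle 0 x -> mxle x xs -> mxle (Ffun M a B x) 0 ->
  forall k : nat,
    mxle (iter k (fmap N P a B1 B2) x) (iter k (fhat M a B) x).
Proof.
move=> [M_M _] a0 B_real B0 [[[xs0 xs_sol] xs_min] xs_gt0 _].
move=> B1_real B2_real B10 B20 B_split N_M P0 M_split x x0 xxs Fx k.
have [M' ME M'Z] := Mmatrix_lift M_M; have [N' NE N'Z] := Mmatrix_lift N_M.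
have [a' aE] := realmx_lift (mxle0_real a0); have [P' PE] := realmx_lift (mxle0_real P0).
have [xs' xsE] := realmx_lift (mxle0_real xs0); have [x' xE] := realmx_lift (mxle0_real x0).
have [B' BE] := real_tensor_lift B_real.
have [B1' B1E] := real_tensor_lift B1_real; have [B2' B2E] := real_tensor_lift B2_real.
have embed_inj m p (U V : 'M[realsub C]_(m, p)) :
    embed U = embed V -> U = V.
  exact: map_mx_inj.
have {}M_split : M' = N' - P' by apply: embed_inj; rewrite map_mxB -ME -NE -PE.
subst M N a P xs x.
have coef (D : tensor C n) D' : nonneg_bil D ->
    (forall i j k, D i j k = realsub_val (D' i j k)) -> forall i j k, 0 <= D' i j k.
  move=> D0 DE i j l; change (0 <= realsub_val (D' i j l)).
  by rewrite -DE; apply: nonneg_bil_coef.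
have embed0 m p (U : 'M[realsub C]_(m, p)) : mxle 0 (embed U) -> lemx 0 U.
  by move=> U0; apply/mxle_embed; rewrite map_mx0.
(* Solutions over the real subfield embed as solutions over [C], so minimality of [xs] descends to
   the subfield. *)
have solE y : M' *m y = a' + bmx B' y *m y <->
    embed M' *m embed y = embed a' + bil B (embed y) (embed y).
  rewrite (bil_embed _ _ BE) -map_mxM -map_mxD.
  by split=> [->|/embed_inj].
(* Products, sums and inverses commute with the embedding, hence so do both iterations. *)
have fE j : iter j (fmap (embed N') (embed P') (embed a') B1 B2) (embed x') =
    embed (iter j (split_map a' B1' B2' N' P') x').
  elim: j => //= j ->.
  rewrite /fmap /Jmap /gmap (bilR_embed _ B1E) (bil_embed _ _ B2E).
  by rewrite !(map_mxM, map_invmx, map_mxB, map_mxD).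
have gE j : iter j (fhat (embed M') (embed a') B) (embed x') =
    embed (iter j (full_map M' a' B') x').
  elim: j => //= j ->.
  by rewrite /fhat (bilR_embed _ BE) !(map_mxM, map_invmx, map_mxB).
rewrite fE gE; apply/mxle_embed.
apply: (@iter_split_le_full _ n M' a' B' M'Z (embed0 _ _ _ a0) (coef _ _ B0 BE) xs').
- by move=> i; have := xs_gt0 i 0; rewrite mxE.
- exact/solE.
- move=> y y0 /solE ysol; apply/mxle_embed/xs_min; split=> //.
  by rewrite -[0](map_mx0 (@realsub_val C)); apply/mxle_embed.
- exact: coef B1E.
- exact: coef B2E.
- by move=> i j l; apply: val_inj; rewrite /= -BE B_split B1E B2E.
- exact: N'Z.
- exact: embed0.
- exact: M_split.
split; [exact: embed0 | exact/mxle_embed |].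
move: Fx; rewrite /Ffun (bil_embed _ _ BE) -map_mxM -!map_mxB.
rewrite -(map_mx0 (@realsub_val C)) => /mxle_embed.
move: (M' *m x') (bmx B' x' *m x') => U V Fx i j.
by have := Fx i j; rewrite !mxE -addrA -opprD subr_le0.
Qed.
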